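(* Let $(X_n,x_n)$, $n\ge1$, and $(X,x)$ be pointed proper geodesically complete CAT$(-1)$ spaces. If $(X_n,x_n)\to(X,x)$ in the pointed Gromov-Hausdorff sense, then the associated visual metric spaces satisfy $(\partial X_n,\rho_{x_n})\to(\partial X,\rho_x)$ in the usual Gromov-Hausdorff sense (as compact metric spaces).
   Context: A metric space is geodesically complete if every geodesic segment extends to a bi-infinite geodesic. For a CAT$(-1)$ space $X$ and $x\in X$, the Gromov product $(y|z)_x=\frac12(d(y,x)+d(z,x)-d(y,z))$ extends continuously to the Gromov boundary $\partial X$, and $\rho_x(\xi,\eta)=\exp(-(\xi|\eta)_x)$ on $\partial X$ is the visual metric based at $x$; it is a metric (Bourdon), and $(\partial X,\rho_x)$ is compact when $X$ is proper. Pointed Gromov-Hausdorff convergence: a map $f:X\to Y$ of metric spaces (not necessarily continuous) is an $\epsilon$-isometry if $\sup_{x_1,x_2}|d_Y(f(x_1),f(x_2))-d_X(x_1,x_2)|<\epsilon$ and $Y=\bigcup_{x\in X}B_Y(f(x),\epsilon)$. For pointed proper geodesic metric spaces, $(X_n,p_n)\to(X,p)$ means: for every $R>0$ and $\epsilon>0$ there is $n_0$ such that for all $n\ge n_0$ there is an $\epsilon$-isometry $f:B_{X_n}(p_n,R)\to B_X(p,R)$ with $f(p_n)=p$. Balls $B_X(p,R)$ are closed. *)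

(* Defs.v *)
From HB Require Import structures.
From mathcomp Require Import all_boot all_order all_algebra.
From mathcomp Require Import all_classical all_reals all_analysis.

Set Implicit Arguments.
Unset Strict Implicit.
Unset Printing Implicit Defensive.

Import Order.TTheory GRing.Theory Num.Theory.
Import numFieldNormedType.Exports.

Local Open Scope classical_set_scope.
Local Open Scope ring_scope.

Definition mclosed_ball (R : realType) (X : metricType R) (p : X) (r : R) :
  set X := [set y | mdist p y <= r].

Definition proper_space (R : realType) (X : metricType R) : Prop :=
  forall (p : X) (r : R), compact (mclosed_ball p r).

Definition geodesic_on (R : realType) (X : metricType R) (I : set R)
    (c : R -> X) : Prop :=
  forall s t : R, I s -> I t -> mdist (c s) (c t) = `|s - t|.

Definition geodesic_segment (R : realType) (X : metricType R) (p q : X)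
    (c : R -> X) : Prop :=
  [/\ geodesic_on `[0, mdist p q] c, c 0 = p & c (mdist p q) = q].

Definition geodesic_space (R : realType) (X : metricType R) : Prop :=
  forall p q : X, exists c : R -> X, geodesic_segment p q c.

(* Segments are nondegenerate (a < b), so that a one-point space, whose
   boundary is empty, counts as geodesically complete. *)
Definition geodesically_complete (R : realType) (X : metricType R) : Prop :=
  forall (a b : R) (c : R -> X), a < b -> geodesic_on `[a, b] c ->
  exists2 l : R -> X, geodesic_on setT l & {in `[a, b], l =1 c}.

(* The hyperbolic plane of curvature -1: the upper sheet of the hyperboloid
   x^2 + y^2 - t^2 = -1, with cosh d(u, v) = t t' - x x' - y y'. *)
Record hyp_plane (R : realType) := HypPlane {
  hyp_t : R;
  hyp_x : R;
  hyp_y : R;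
  hyp_sheet : hyp_x ^+ 2 + hyp_y ^+ 2 - hyp_t ^+ 2 = -1;
  hyp_t_gt0 : 0 < hyp_t }.

Definition arcosh (R : realType) (s : R) : R := ln (s + Num.sqrt (s ^+ 2 - 1)).

Definition hyp_dist (R : realType) (u v : hyp_plane R) : R :=
  arcosh (hyp_t u * hyp_t v - hyp_x u * hyp_x v - hyp_y u * hyp_y v).

Definition comparison_triangle (R : realType) (X : metricType R) (p q r : X)
    (p' q' r' : hyp_plane R) : Prop :=
  [/\ hyp_dist p' q' = mdist p q, hyp_dist p' r' = mdist p r
    & hyp_dist q' r' = mdist q r].

(* x' is the point of the side [p', q'] that corresponds to x in [p, q]. *)
Definition comparison_point (R : realType) (X : metricType R) (p q x : X)
    (p' q' x' : hyp_plane R) : Prop :=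
  hyp_dist p' x' = mdist p x /\ hyp_dist x' q' = mdist x q.

(* Only points on two sides issuing from the vertex p are compared: up to
   relabelling the vertices these are all pairs of points on distinct sides,
   and two points on one side satisfy the inequality with equality. *)
Definition CATm1 (R : realType) (X : metricType R) : Prop :=
  geodesic_space X /\
  forall (p q r : X) (c1 c2 : R -> X),
    geodesic_segment p q c1 -> geodesic_segment p r c2 ->
  forall (s t : R), 0 <= s <= mdist p q -> 0 <= t <= mdist p r ->
  forall p' q' r' x' y' : hyp_plane R,
    comparison_triangle p q r p' q' r' ->
    comparison_point p q (c1 s) p' q' x' ->
    comparison_point p r (c2 t) p' r' y' ->
    mdist (c1 s) (c2 t) <= hyp_dist x' y'.

Definition gromov_product (R : realType) (X : metricType R) (x y z : X) : R :=
  (mdist y x + mdist z x - mdist y z) / 2.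

Definition gromov_equiv (R : realType) (X : metricType R) (u v : nat -> X) :
    Prop :=
  forall p : X,
    gromov_product p (u ij.1) (v ij.2) @[ij --> (\oo, \oo)] --> +oo.

Definition gromov_seq (R : realType) (X : metricType R) (u : nat -> X) : Prop :=
  gromov_equiv u u.

Definition gromov_class (R : realType) (X : metricType R) (u : nat -> X) :
    set (nat -> X) :=
  [set v | gromov_seq v /\ gromov_equiv u v].

(* A point of the boundary is the class of a sequence converging to infinity;
   a sequence belongs to the class exactly when it converges to that point. *)
Definition gromov_boundary (R : realType) (X : metricType R) : Type :=
  {xi : set (nat -> X) | exists2 u, gromov_seq u & xi = gromov_class u}.

(* The continuous extension of the Gromov product to the boundary: the common
   limit of (u_i | v_j)_x over all u_i -> xi and v_j -> eta; it is +oo when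
   xi = eta, whence the extended reals. *)
Definition boundary_gromov_product (R : realType) (X : metricType R) (x : X)
    (xi eta : gromov_boundary X) : \bar R :=
  get [set l : \bar R | forall u v : nat -> X, sval xi u -> sval eta v ->
    (gromov_product x (u ij.1) (v ij.2))%:E @[ij --> (\oo, \oo)] --> l].

Definition visual_metric (R : realType) (X : metricType R) (x : X)
    (xi eta : gromov_boundary X) : R :=
  fine (expeR (- boundary_gromov_product x xi eta)%E).

Definition eps_isometry (R : realType) (X Y : metricType R) (A : set X)
    (B : set Y) (eps : R) (f : X -> Y) : Prop :=
  [/\ forall a, A a -> B (f a),
      (ereal_sup [set `|mdist (f a.1) (f a.2) - mdist a.1 a.2|%:E
                 | a in A `*` A] < eps%:E)%E
    & B `<=` \bigcup_(a in A) mclosed_ball (f a) eps].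

(* Only the values on the ball of X_ n matter for f below, so taking f to be
   defined on all of X_ n is no restriction. *)
Definition pointed_GH_cvg (R : realType) (X_ : nat -> metricType R)
    (x_ : forall n, X_ n) (X : metricType R) (x : X) : Prop :=
  forall r eps : R, 0 < r -> 0 < eps -> \forall n \near \oo,
    exists2 f : X_ n -> X,
      eps_isometry (mclosed_ball (x_ n) r) (mclosed_ball x r) eps f
      & f (x_ n) = x.

Definition hausdorff_distance (R : realType) (Z : metricType R) (A B : set Z) :
    \bar R :=
  ereal_inf [set e%:E | e in [set e : R | [/\ 0 <= e,
    A `<=` \bigcup_(b in B) mclosed_ball b e
    & B `<=` \bigcup_(a in A) mclosed_ball a e]]].

(* The distance functions dS and dT are plain functions: the infimum is over
   all isometric embeddings of (S, dS) and (T, dT) into a common metric space,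
   so it is +oo unless dS and dT are metrics. *)
Definition gromov_hausdorff_distance (R : realType) (S T : Type)
    (dS : S -> S -> R) (dT : T -> T -> R) : \bar R :=
  ereal_inf [set h : \bar R | exists (Z : metricType R) (f : S -> Z) (g : T -> Z),
    [/\ injective f /\ (forall a b, mdist (f a) (f b) = dS a b),
        injective g /\ (forall a b, mdist (g a) (g b) = dT a b)
      & h = hausdorff_distance (range f) (range g)]].

(* Main.v *)
Require Import Defs.
From HB Require Import structures.
From mathcomp Require Import all_boot all_order all_algebra.
From mathcomp Require Import all_classical all_reals all_analysis.
From mathcomp Require Import ring lra.

(** The proof rests on strong hyperbolicity: in a CAT(-1) space the quantity
    exp (- (y | z)_x) satisfies the triangle inequality for all points y, z of
    the space, and not only on the boundary ([visual_dist_triangle]).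
    Equivalently, e^(d / 2) satisfies Ptolemy's inequality for the quadruples of
    points ([four_points]). To see this, let m be a point of the segment
    [o, w]. Comparison with the hyperbolic plane gives Stewart's inequality for
    cosh d(m, y) ([coshR_stewart]), hence for e^d(m, y) ([expR_stewart]). As
    d(y, z) <= d(y, m) + d(m, z), the product of these bounds for y and z bounds
    e^d(y, z), and at the right m it is a multiple of a perfect square, which
    yields the inequality.

    Consequently exp (- (u_i | v_j)_x) converges along any two Gromov sequences
    u and v, its limit depends only on their classes, and this limit is the
    visual metric ([visual_metric_cvg]), which is therefore a metric.

    For the convergence, let f be a d-isometry between the balls of radius r
    about the base points of two such spaces. Every boundary point is within
    2 exp (- r) of a point of the sphere of radius r
    ([exists_shadowing_point]), and by geodesic completeness every point at
    distance s > 0 from the base point is within exp (- s) of a boundary point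
    ([exists_shadowed_boundary_point]). So f induces a correspondence between
    the two boundaries, in which related boundary points lie behind a point of
    the ball and its image. Since visual distances between points of the ball
    are nearly preserved by f, the correspondence distorts the visual metrics by
    at most 2 (2 exp (2 - r) + d), and gluing the boundaries along it bounds
    their Gromov-Hausdorff distance by half of that
    ([gromov_hausdorff_boundary_le]). This tends to 0 for r large and d
    small. *)

Set Implicit Arguments.
Unset Strict Implicit.
Unset Printing Implicit Defensive.

Import Order.TTheory GRing.Theory Num.Theory.
Import numFieldNormedType.Exports.
Local Open Scope classical_set_scope.
Local Open Scope ring_scope.

(** * Hyperbolic functions *)

Section hyperbolic_functions.
Context {R : realType}.
Implicit Types x y s : R.

Definition coshR x : R := (expR x + expR (- x)) / 2.
Definition sinhR x : R := (expR x - expR (- x)) / 2.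

Lemma expRMN x : expR x * expR (- x) = 1.
Proof. by rewrite -expRD subrr expR0. Qed.

Lemma expR_cosh_sinh x : expR x = coshR x + sinhR x.
Proof. by rewrite /coshR /sinhR; field. Qed.

Lemma cosh2_sinh2 x : coshR x ^+ 2 - sinhR x ^+ 2 = 1.
Proof. by rewrite -(expRMN x) /coshR /sinhR; field. Qed.

Lemma coshRD x y : coshR (x + y) = coshR x * coshR y + sinhR x * sinhR y.
Proof. by rewrite /coshR /sinhR opprD !expRD; field. Qed.

Lemma sinhRD x y : sinhR (x + y) = sinhR x * coshR y + coshR x * sinhR y.
Proof. by rewrite /coshR /sinhR opprD !expRD; field. Qed.

Lemma coshRN x : coshR (- x) = coshR x.
Proof. by rewrite /coshR opprK addrC. Qed.

Lemma sinhRN x : sinhR (- x) = - sinhR x.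
Proof. by rewrite /sinhR opprK; field. Qed.

Lemma sinhR0 : sinhR 0 = 0.
Proof. by rewrite /sinhR oppr0 subrr mul0r. Qed.

Lemma coshRB x y : coshR (x - y) = coshR x * coshR y - sinhR x * sinhR y.
Proof. by rewrite coshRD coshRN sinhRN mulrN. Qed.

Lemma sinhRB x y : sinhR (x - y) = sinhR x * coshR y - coshR x * sinhR y.
Proof. by rewrite sinhRD coshRN sinhRN mulrN. Qed.

Lemma coshR_gt0 x : 0 < coshR x.
Proof. by rewrite divr_gt0// addr_gt0// expR_gt0. Qed.

Lemma coshR_ge1 x : 1 <= coshR x.
Proof.
have := cosh2_sinh2 x; have := coshR_gt0 x; have := sqr_ge0 (sinhR x).
by nra.
Qed.

Lemma sinhR_ge0 x : 0 <= x -> 0 <= sinhR x.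
Proof. by move=> x0; rewrite divr_ge0// subr_ge0 ler_expR; lra. Qed.

Lemma sinhR_gt0 x : 0 < x -> 0 < sinhR x.
Proof. by move=> x0; rewrite divr_gt0// subr_gt0 ltr_expR; lra. Qed.

Lemma ler_coshR x y : `|x| <= y -> coshR x <= coshR y.
Proof.
wlog x0 : x / 0 <= x => [h|].
  have [x0|x0] := leP 0 x; first exact: h.
  by rewrite -normrN -(coshRN x); apply: h; lra.
rewrite ger0_norm// => xy.
have y0 : 0 <= y - x by lra.
rewrite -[leRHS](congr1 coshR (subrK x y)) coshRD.
by have := coshR_ge1 (y - x); have := coshR_ge1 x; have := sinhR_ge0 y0;
  have := sinhR_ge0 x0; nra.
Qed.

Lemma sqrt_coshR2 x : 0 <= x -> Num.sqrt (coshR x ^+ 2 - 1) = sinhR x.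
Proof.
move=> x0; rewrite -(cosh2_sinh2 x) opprB addrC subrK sqrtr_sqr ger0_norm//.
exact: sinhR_ge0.
Qed.

Lemma coshRK x : 0 <= x -> arcosh (coshR x) = x.
Proof. by move=> x0; rewrite /arcosh sqrt_coshR2// -expR_cosh_sinh expRK. Qed.

Lemma arcoshK s : 1 <= s -> coshR (arcosh s) = s.
Proof.
move=> s1; rewrite /arcosh.
have q2 : Num.sqrt (s ^+ 2 - 1) ^+ 2 = s ^+ 2 - 1 by rewrite sqr_sqrtr; nra.
have q0 := sqrtr_ge0 (s ^+ 2 - 1).
set q := Num.sqrt _ in q2 q0 *.
have w0 : 0 < s + q by lra.
rewrite /coshR expRN !lnK ?posrE//.
have -> : (s + q)^-1 = s - q.
  by apply: (mulfI (lt0r_neq0 w0)); rewrite divff ?lt0r_neq0//; nra.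
by field.
Qed.

(** The squared length of a geodesic combination: this is the identity that
    makes the weights sinh (t - tau) / sinh t and sinh tau / sinh t behave as
    the coordinates of a unit vector for the form u^2 + v^2 + 2 u v cosh t. *)
Lemma sinhR_split (t tau : R) :
  sinhR (t - tau) ^+ 2 + sinhR tau ^+ 2 +
  2 * sinhR (t - tau) * sinhR tau * coshR t = sinhR t ^+ 2.
Proof.
have h1 := congr1 ( *%R (sinhR t ^+ 2)) (cosh2_sinh2 tau).
have h2 := congr1 ( *%R (sinhR tau ^+ 2)) (cosh2_sinh2 t).
by rewrite sinhRB; lra.
Qed.

End hyperbolic_functions.

(** Solving for e^(2 tau) gives (B + A e^t) / (B + A e^-t), which lies between
    1 and e^(2 t). *)
Lemma balance_point {R : realType} (t A B : R) : 0 <= t -> 0 < A -> 0 < B ->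
  exists2 tau, 0 <= tau <= t & A * sinhR (t - tau) = B * sinhR tau.
Proof.
move=> t0 A0 B0.
have eA : 0 < B + A * expR t by rewrite addr_gt0// mulr_gt0// expR_gt0.
have eB : 0 < B + A * expR (- t) by rewrite addr_gt0// mulr_gt0// expR_gt0.
pose q := (B + A * expR t) / (B + A * expR (- t)).
have q0 : 0 < q by rewrite divr_gt0.
have qE : q * (B + A * expR (- t)) = B + A * expR t by rewrite /q divfK// lt0r_neq0.
have tt : expR (- t) <= expR t by rewrite ler_expR; lra.
have et := expRMN t.
have e1 : 1 <= expR t by rewrite -[1]expR0 ler_expR.
exists (ln q / 2).
  apply/andP; split.
    by rewrite divr_ge0// ln_ge0// ler_pdivlMr// mul1r lerD2l ler_pM2l.
  have tE : t = ln (expR t ^+ 2) / 2.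
    by rewrite lnXn ?expR_gt0// expRK -(mulr_natr t) mulfK// pnatr_eq0.
  rewrite [leRHS]tE.
  rewrite ler_pM2r ?invr_gt0// ler_ln ?posrE ?exprn_gt0 ?expR_gt0//.
  rewrite ler_pdivrMr//.
  have BB : B <= expR t ^+ 2 * B by rewrite ler_peMl ?(ltW B0)// exprn_ege1.
  by have := congr1 ( *%R (A * expR t)) et; lra.
set tau := ln q / 2.
have qq : expR tau * expR tau = q.
  by rewrite -expRD /tau -mulrDl -mulr2n -(mulr_natr (ln q)) mulfK
    ?lnK ?posrE ?pnatr_eq0.
have etau := expRMN tau.
have ep := expR_gt0 tau.
rewrite /sinhR opprB !expRD.
apply: (mulfI (lt0r_neq0 ep)).
rewrite -qq in qE.
by nra.
Qed.

(** * Stewart's inequality in CAT(-1) spaces *)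

Lemma ler_coshR_arcosh {R : realType} (d s : R) :
  0 <= d -> 1 <= s -> d <= arcosh s -> coshR d <= s.
Proof. by move=> d0 s1 ds; rewrite -[s]arcoshK// ler_coshR// ger0_norm. Qed.

Lemma sheet_axis {R : realType} (t : R) :
  sinhR t ^+ 2 + 0 ^+ 2 - coshR t ^+ 2 = -1 :> R.
Proof. by have := cosh2_sinh2 t; lra. Qed.

(** The polar coordinates (r, theta) of the hyperboloid with
    k = sinh r * cos theta as parameter in place of the angle, which avoids a
    division by sinh r when the two points coincide. *)
Lemma sheet_cosine {R : realType} (r k : R) : k ^+ 2 <= sinhR r ^+ 2 ->
  k ^+ 2 + Num.sqrt (sinhR r ^+ 2 - k ^+ 2) ^+ 2 - coshR r ^+ 2 = -1 :> R.
Proof.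
by move=> kr; rewrite sqr_sqrtr ?subr_ge0//; have := cosh2_sinh2 r; lra.
Qed.

Definition axis_point {R : realType} (t : R) : hyp_plane R :=
  HypPlane (sheet_axis t) (coshR_gt0 t).

Lemma hyp_dist_axis {R : realType} (s t : R) : s <= t ->
  hyp_dist (axis_point s) (axis_point t) = t - s.
Proof.
move=> st; rewrite /hyp_dist/= mulr0 subr0 -coshRB -coshRN opprB coshRK//.
by rewrite subr_ge0.
Qed.

(** Stewart's theorem, as an inequality. In the hyperbolic plane, along a unit
    speed geodesic the function cosh d(-, y) solves f'' = f, hence it is the
    combination of its values at the ends o and w with the weights
    sinh (t - tau) / sinh t and sinh tau / sinh t. The comparison inequality
    bounds the distance in X by the one in the plane. *)
Lemma coshR_stewart {R : realType} (X : metricType R) : CATm1 X ->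
  forall (o w y : X) (c : R -> X) (tau : R), geodesic_segment o w c ->
  0 < mdist o w -> 0 <= tau <= mdist o w ->
  sinhR (mdist o w) * coshR (mdist (c tau) y) <=
  sinhR (mdist o w - tau) * coshR (mdist o y) +
  sinhR tau * coshR (mdist w y).
Proof.
move=> [geo cat] o w y c tau gc t0 tau0t.
have [c2 gc2] := geo o y.
have := cat o w y c c2 gc gc2 tau (mdist o y) tau0t.
rewrite mdist_ge0 lexx => /(_ isT).
have [cg c0 cw] := gc; have [_ _ c2y] := gc2; rewrite c2y.
have [tau0 taut] := andP tau0t.
have dot : mdist o (c tau) = tau.
  rewrite -c0 cg/= ?in_itv/= ?lexx ?(ltW t0)//.
  by rewrite sub0r normrN ger0_norm.
have dtw : mdist (c tau) w = mdist o w - tau.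
  rewrite -{1}cw cg/= ?in_itv/= ?lexx ?(ltW t0)//.
  by rewrite distrC ger0_norm// subr_ge0.
have r0 := mdist_ge0 o y; have a0 := mdist_ge0 w y.
have tr1 := metric_triangle o w y.
have tr2 := metric_triangle o y w; rewrite (metric_sym y w) in tr2.
have tr3 := metric_triangle w o y; rewrite (metric_sym w o) in tr3.
have ht : 0 < sinhR (mdist o w) by exact: sinhR_gt0.
move: dot dtw r0 a0 tr1 tr2 tr3 ht.
move: taut t0 {c0 cg cw gc gc2 c2y tau0t} => {cat geo}.
rewrite /comparison_triangle /comparison_point.
move: (mdist_ge0 (c tau) y).
rewrite mdistxx.
set t := mdist o w; set r := mdist o y; set a := mdist w y.
set d := mdist (c tau) y => d0 taut t0 -> -> r0 a0 tr1 tr2 tr3 ht.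
(* The vertex p' lies at the origin, q' on the axis at distance t, and r' is
   given by the law of cosines, which determines k = sinh r * cos theta. *)
pose k := (coshR t * coshR r - coshR a) / sinhR t.
have kE : sinhR t * k = coshR t * coshR r - coshR a.
  by rewrite /k mulrC divfK// lt0r_neq0.
have lek : `|k| <= sinhR r.
  rewrite ler_norml; apply/andP; split; rewrite -(ler_pM2l ht) kE.
    have : coshR a <= coshR (t + r) by apply: ler_coshR; rewrite ger0_norm//; lra.
    by rewrite coshRD; nra.
  have : coshR (t - r) <= coshR a by apply: ler_coshR; rewrite ler_norml; lra.
  by rewrite coshRB; nra.
have hr := sinhR_ge0 r0.
have lek2 : k ^+ 2 <= sinhR r ^+ 2 by rewrite -real_normK ?num_real// lerXn2r// nnegrE.
pose r' := HypPlane (sheet_cosine lek2) (coshR_gt0 r).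
have dr s : hyp_dist (axis_point s) r' = arcosh (coshR s * coshR r - sinhR s * k).
  by rewrite /hyp_dist/= mul0r subr0.
move=> /(_ (axis_point 0) (axis_point t) r' (axis_point tau) r').
have dor : hyp_dist (axis_point 0) r' = r.
  rewrite dr sinhR0 mul0r subr0 /coshR oppr0 expR0 -[(1 + 1) / 2]/(2 / 2) divff//.
  by rewrite mul1r coshRK.
have drr : hyp_dist r' r' = 0.
  rewrite /hyp_dist/= -!expr2 sqr_sqrtr ?subr_ge0//.
  have -> : coshR r ^+ 2 - k ^+ 2 - (sinhR r ^+ 2 - k ^+ 2) = 1.
    by have := cosh2_sinh2 r; lra.
  by rewrite /arcosh expr1n subrr sqrtr0 addr0 ln1.
have dwr : hyp_dist (axis_point t) r' = a by rewrite dr kE opprB addrC subrK coshRK.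
rewrite !hyp_dist_axis ?subr0// ?(ltW t0)// dor drr dwr.
move=> /(_ (And3 erefl erefl erefl)).
move=> /(_ (conj erefl erefl) (conj erefl erefl)).
rewrite dr => /ler_coshR_arcosh-/(_ d0).
(* Undoing arcosh needs an argument that is at least 1; this follows from
   |k| <= sinh r. *)
have s1 : 1 <= coshR tau * coshR r - sinhR tau * k.
  apply: (le_trans (coshR_ge1 (tau - r))); rewrite coshRB lerD2l lerN2.
  by apply: ler_wpM2l; [exact: sinhR_ge0|apply: le_trans lek; exact: ler_norm].
move=> /(_ s1) dC; apply: (le_trans (ler_wpM2l (ltW ht) dC)).
have := congr1 ( *%R (sinhR tau)) kE.
by rewrite sinhRB; lra.
Qed.

(** The same estimate holds for e^d = cosh d + sinh d. With u and v the weights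
    of the previous lemma, and r and a the distances from y to the ends,
    (u cosh r + v cosh a)^2 - (u sinh r + v sinh a)^2
      = u^2 + v^2 + 2 u v cosh (r - a),
    which is at most u^2 + v^2 + 2 u v cosh t = 1 since |r - a| <= t. So the
    bound on cosh d yields the one on sinh d = sqrt (cosh^2 d - 1). Passing to
    e^d makes the bound compatible with products, as e^(d + d') = e^d e^d'. *)
Lemma expR_stewart {R : realType} (X : metricType R) : CATm1 X ->
  forall (o w y : X) (c : R -> X) (tau : R), geodesic_segment o w c ->
  0 < mdist o w -> 0 <= tau <= mdist o w ->
  sinhR (mdist o w) * expR (mdist (c tau) y) <=
  sinhR (mdist o w - tau) * expR (mdist o y) + sinhR tau * expR (mdist w y).
Proof.
move=> cat o w y c tau gc t0 tau0t.
have C := coshR_stewart cat y gc t0 tau0t.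
have tr2 := metric_triangle o y w; rewrite (metric_sym y w) in tr2.
have tr1 := metric_triangle o w y.
have tr3 := metric_triangle w o y; rewrite (metric_sym w o) in tr3.
have r0 := mdist_ge0 o y; have a0 := mdist_ge0 w y.
have d0 := mdist_ge0 (c tau) y.
have [tau0 taut] := andP tau0t.
move: C tr1 tr2 tr3 r0 a0 d0 t0 taut {gc tau0t}.
set t := mdist o w; set r := mdist o y; set a := mdist w y.
set d := mdist (c tau) y => C tr1 tr2 tr3 r0 a0 d0 t0 taut.
rewrite !expR_cosh_sinh.
have ht : 0 < sinhR t by exact: sinhR_gt0.
have hu : 0 <= sinhR (t - tau) by apply: sinhR_ge0; lra.
have hv := sinhR_ge0 tau0; have hd := sinhR_ge0 d0.
have hr := sinhR_ge0 r0; have ha := sinhR_ge0 a0.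
have uv := sinhR_split t tau.
suff S : sinhR t * sinhR d <= sinhR (t - tau) * sinhR r + sinhR tau * sinhR a.
  by lra.
have rat : coshR (r - a) <= coshR t by apply: ler_coshR; rewrite ler_norml; lra.
rewrite -ler_sqr ?nnegrE; last 2 first.
- by rewrite mulr_ge0// ltW.
- by rewrite addr_ge0// mulr_ge0.
have C2 : (sinhR t * coshR d) ^+ 2 <=
    (sinhR (t - tau) * coshR r + sinhR tau * coshR a) ^+ 2.
  by rewrite ler_sqr// nnegrE ?addr_ge0// mulr_ge0// ?(ltW ht)// ltW// coshR_gt0.
have uvr : sinhR (t - tau) * sinhR tau * coshR (r - a) <=
    sinhR (t - tau) * sinhR tau * coshR t by rewrite ler_wpM2l// mulr_ge0.
rewrite coshRB in uvr.
have h1 := congr1 ( *%R (sinhR t ^+ 2)) (cosh2_sinh2 d).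
have h2 := congr1 ( *%R (sinhR (t - tau) ^+ 2)) (cosh2_sinh2 r).
have h3 := congr1 ( *%R (sinhR tau ^+ 2)) (cosh2_sinh2 a).
by lra.
Qed.

(** * Strong hyperbolicity *)

(** The numerical core of strong hyperbolicity: dy and dz are the distances
    from the endpoints y and z to a point at position tau of a segment of
    length t, and the bounds on e^dy and e^dz come from the exponential form of
    Stewart's inequality. With U and V the two sinh weights, S = sinh t,
    P = e^((r + b) / 2) and Q = e^((a + s) / 2), the balance condition turns the
    product of the two bounds into a multiple of a perfect square,
    S^2 e^d <= U V (P + Q)^2, while S^2 = U^2 + V^2 + 2 U V cosh t is at least
    U V e^t by the inequality of arithmetic and geometric means. *)
Lemma four_points_aux {R : realType} (a b r s t d dy dz tau : R) :
  0 < t -> 0 <= tau <= t -> d <= dy + dz ->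
  sinhR t * expR dy <= sinhR (t - tau) * expR r + sinhR tau * expR a ->
  sinhR t * expR dz <= sinhR (t - tau) * expR s + sinhR tau * expR b ->
  expR ((r + s) / 2) * sinhR (t - tau) = expR ((a + b) / 2) * sinhR tau ->
  expR ((d + t) / 2) <= expR ((r + b) / 2) + expR ((a + s) / 2).
Proof.
move=> t0 /andP[tau0 taut] ddd hy hz bal.
have S0 := sinhR_gt0 t0.
have U0 : 0 <= sinhR (t - tau) by rewrite sinhR_ge0// subr_ge0.
have V0 := sinhR_ge0 tau0.
have ssE := sinhR_split t tau.
set U := sinhR (t - tau) in U0 hy hz bal ssE *.
set V := sinhR tau in V0 hy hz bal ssE *.
set S := sinhR t in S0 hy hz ssE *.
have half z : expR z = expR (z / 2) ^+ 2 :> R.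
  by rewrite expr2 -expRD -splitr.
have Ar : expR ((r + s) / 2) = expR (r / 2) * expR (s / 2) by rewrite -expRD mulrDl.
have Bab : expR ((a + b) / 2) = expR (a / 2) * expR (b / 2) by rewrite -expRD mulrDl.
rewrite Ar Bab in bal.
rewrite (half r) (half a) in hy; rewrite (half s) (half b) in hz.
have -> : expR ((r + b) / 2) = expR (r / 2) * expR (b / 2) by rewrite -expRD mulrDl.
have -> : expR ((a + s) / 2) = expR (a / 2) * expR (s / 2) by rewrite -expRD mulrDl.
move: (expR_gt0 (r / 2)) (expR_gt0 (s / 2)) (expR_gt0 (a / 2)) (expR_gt0 (b / 2)).
move: (expR (r / 2)) (expR (s / 2)) (expR (a / 2)) (expR (b / 2)) hy hz bal
  => r' s' a' b' hy hz bal r0 s0 a0 b0.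
have UV0 : 0 < U * V.
  have [|U1] := eqVneq U 0.
    move=> UE; rewrite UE mulr0 in bal; have /eqP := esym bal.
    rewrite mulf_eq0 (gt_eqF (mulr_gt0 a0 b0))/= => /eqP VE.
    by move: ssE; rewrite UE VE; nra.
  have {}U1 : 0 < U by rewrite lt_def U1.
  rewrite mulr_gt0// lt_def V0 andbT; apply/eqP => VE.
  by have := mulr_gt0 (mulr_gt0 r0 s0) U1; rewrite bal VE mulr0 ltxx.
have prod : S ^+ 2 * expR d <= U * V * (r' * b' + a' * s') ^+ 2.
  have -> : U * V * (r' * b' + a' * s') ^+ 2 =
      (U * r' ^+ 2 + V * a' ^+ 2) * (U * s' ^+ 2 + V * b' ^+ 2).
    have h1 := congr1 ( *%R (r' * s' * U)) bal.
    have h2 := congr1 ( *%R (a' * b' * V)) bal.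
    by lra.
  apply: (@le_trans _ _ ((S * expR dy) * (S * expR dz))).
    rewrite mulrACA -expRD -expr2 ler_pM2l ?exprn_gt0//.
    by rewrite ler_expR.
  by apply: ler_pM => //; rewrite mulr_ge0// ?expR_ge0// ltW.
have UVS : U * V * expR t <= S ^+ 2.
  rewrite -ssE expR_cosh_sinh /coshR /sinhR.
  have := sqr_ge0 (U - V); have := mulr_ge0 (ltW UV0) (expR_ge0 (- t)).
  by have := ltW UV0; lra.
rewrite -ler_sqr ?nnegrE ?expR_ge0//; last first.
  by rewrite addr_ge0// mulr_ge0// ltW.
rewrite -half expRD -(ler_pM2l UV0); apply: le_trans prod.
by rewrite mulrCA mulrC ler_pM2r ?expR_gt0.
Qed.

(** Ptolemy's inequality for e^(d / 2): strong hyperbolicity. The broken path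
    from y to z through any point of the segment [o, w] is at least as long as
    [y, z]. The chosen point is the one at which the product of the two bounds
    of Stewart's inequality is smallest relative to the product of the weights,
    the equality case of the inequality of arithmetic and geometric means. *)
Lemma four_points {R : realType} (X : metricType R) : CATm1 X ->
  forall o y z w : X,
  expR ((mdist y z + mdist o w) / 2) <=
  expR ((mdist o y + mdist w z) / 2) + expR ((mdist w y + mdist o z) / 2).
Proof.
move=> cat o y z w.
have [ow|] := eqVneq o w.
  rewrite -ow mdistxx addr0; apply: (@le_trans _ _ (expR ((mdist o y + mdist o z) / 2))).
    rewrite ler_expR ler_pM2r ?invr_gt0// (metric_sym o y); exact: metric_triangle.
  by rewrite lerDl expR_ge0.
rewrite -mdist_gt0 => t0.
have [c gc] := cat.1 o w.
have [tau tau0t bal] := balance_point (ltW t0)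
  (expR_gt0 ((mdist o y + mdist o z) / 2)) (expR_gt0 ((mdist w y + mdist w z) / 2)).
apply: (four_points_aux t0 tau0t _ (expR_stewart cat y gc t0 tau0t)
  (expR_stewart cat z gc t0 tau0t) bal).
by rewrite -(metric_sym y); exact: metric_triangle.
Qed.

(** The formula of the visual metric, for points of the space itself; at y = z
    it is exp (- d(x, y)), so it is not a metric there. *)
Definition visual_dist {R : realType} (X : metricType R) (x y z : X) : R :=
  expR (- gromov_product x y z).

Section visual_dist.
Context {R : realType} (X : metricType R).
Implicit Types x y z w : X.

Lemma gromov_product_sym x y z : gromov_product x y z = gromov_product x z y.
Proof. by rewrite /gromov_product (metric_sym y z) (addrC (mdist y x)). Qed.

Lemma gromov_product_ge0 x y z : 0 <= gromov_product x y z.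
Proof.
rewrite /gromov_product divr_ge0// subr_ge0 (metric_sym z).
exact: metric_triangle.
Qed.

Lemma gromov_product_base x x' y z :
  gromov_product x y z - mdist x x' <= gromov_product x' y z.
Proof.
rewrite /gromov_product; have := metric_triangle y x' x.
have := metric_triangle z x' x; rewrite (metric_sym x' x).
lra.
Qed.

Lemma visual_dist_sym x y z : visual_dist x y z = visual_dist x z y.
Proof. by rewrite /visual_dist gromov_product_sym. Qed.

Lemma visual_dist_gt0 x y z : 0 < visual_dist x y z.
Proof. exact: expR_gt0. Qed.

(** This is the four point inequality divided by
    exp ((d(x, y) + d(x, z) + d(x, w)) / 2). *)
Lemma visual_dist_triangle : CATm1 X -> forall x y w z,
  visual_dist x y z <= visual_dist x y w + visual_dist x w z.
Proof.
move=> cat x y w z; have := four_points cat x y z w.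
rewrite -(ler_pM2l (expR_gt0 (- (mdist x y + mdist x z + mdist x w) / 2))).
rewrite mulrDr -!expRD /visual_dist /gromov_product.
rewrite !(metric_sym _ x) (metric_sym w y).
move: (mdist _ _) (mdist _ _) (mdist _ _) (mdist _ _) (mdist _ _) (mdist _ _).
move=> xy xz xw yz wz yw.
congr (_ <= _); last rewrite addrC; [|congr +%R]; congr expR; lra.
Qed.

Lemma visual_dist_quad : CATm1 X -> forall x y z y' z',
  `|visual_dist x y z - visual_dist x y' z'| <=
  visual_dist x y y' + visual_dist x z z'.
Proof.
move=> cat x y z y' z'; have T := visual_dist_triangle cat.
rewrite ler_norml; apply/andP; split.
  have := T x y' y z'; have := T x y z z'.
  by rewrite (visual_dist_sym x y' y); lra.
have := T x y y' z; have := T x y' z' z.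
by rewrite (visual_dist_sym x z' z); lra.
Qed.

Lemma dist_expRN (a b : R) : 0 <= a -> 0 <= b ->
  `|expR (- a) - expR (- b)| <= `|a - b|.
Proof.
wlog ab : a b / a <= b => [h a0 b0|a0 b0].
  have [ab|/ltW ba] := leP a b; first exact: h.
  by rewrite distrC (distrC a); exact: h.
have e1 : expR (- b) <= expR (- a) by rewrite ler_expR lerN2.
rewrite ger0_norm ?subr_ge0// distrC ger0_norm ?subr_ge0//.
have -> : expR (- b) = expR (- a) * expR (a - b) by rewrite -expRD; congr expR; lra.
have a1 : expR (- a) <= 1 by rewrite -expR0 ler_expR; lra.
by have := expR_ge1Dx (a - b); have := expR_gt0 (- a); nra.
Qed.

End visual_dist.

(** * The visual metric on the boundary *)

Lemma near_infty2P (P : nat * nat -> Prop) :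
  (\forall ij \near (\oo, \oo), P ij) <->
  exists N, forall i j, (N <= i)%N -> (N <= j)%N -> P (i, j).
Proof.
split.
  move=> [[A B] [/= [m _ mA] [n _ nB]] AB].
  exists (maxn m n) => i j; rewrite !geq_max => /andP[mi _] /andP[_ nj].
  by apply: (AB (i, j)); split; [exact: mA|exact: nB].
move=> [N h]; exists ([set i | (N <= i)%N], [set i | (N <= i)%N]).
  by split; exists N.
by move=> [i j] [/= Ni Nj]; exact: h.
Qed.

Section gromov.
Context {R : realType} (X : metricType R).
Implicit Types (x : X) (u v : nat -> X).

(** Gromov products seen from two base points differ by at most their distance,
    so that equivalence can be tested from one base point. *)
Lemma gromov_equivP x u v : gromov_equiv u v <->
  forall e, 0 < e -> exists N, forall i j, (N <= i)%N -> (N <= j)%N ->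
    visual_dist x (u i) (v j) <= e.
Proof.
split=> [uv e e0|uv p].
  have /cvgryPge/(_ (- ln e))/near_infty2P[N h] := uv x.
  exists N => i j Ni Nj; rewrite /visual_dist -[leRHS](lnK (_ : e \is Num.pos))//.
  by rewrite ler_expR lerNl h.
apply/cvgryPge => M; apply/near_infty2P.
have [N h] := uv _ (expR_gt0 (- (M + mdist x p))).
exists N => i j Ni Nj; have := h _ _ Ni Nj.
rewrite /visual_dist ler_expR lerN2 => le.
by have := gromov_product_base x p (u i) (v j); lra.
Qed.

End gromov.

Section boundary.
Context {R : realType} (X : metricType R) (cat : CATm1 X).
Implicit Types (x y z : X) (u v : nat -> X) (xi eta : gromov_boundary X).

Lemma gromov_equiv_sym u v : gromov_equiv u v -> gromov_equiv v u.
Proof.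
move=> /(gromov_equivP (u 0%N)) uv; apply/(gromov_equivP (u 0%N)) => e /uv[N h].
by exists N => i j Ni Nj; rewrite visual_dist_sym h.
Qed.

Lemma gromov_equiv_trans v u w :
  gromov_equiv u v -> gromov_equiv v w -> gromov_equiv u w.
Proof.
move=> /(gromov_equivP (u 0%N)) uv /(gromov_equivP (u 0%N)) vw.
apply/(gromov_equivP (u 0%N)) => e e0.
have e20 : 0 < e / 2 by rewrite divr_gt0.
have [M hM] := uv _ e20; have [N hN] := vw _ e20.
exists (maxn M N) => i j; rewrite !geq_max => /andP[Mi Ni] /andP[Mj Nj].
have := visual_dist_triangle cat (u 0%N) (u i) (v (maxn M N)) (w j).
have := hM i (maxn M N) Mi (leq_maxl _ _).
have := hN (maxn M N) j (leq_maxr _ _) Nj; lra.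
Qed.

Lemma boundary_rep xi : exists u, sval xi u.
Proof. by case: xi => A [u gu AE] /=; exists u; rewrite AE; split. Qed.

Lemma boundary_seq xi u : sval xi u -> gromov_seq u.
Proof. by case: xi => A [w gw AE] /=; rewrite AE => -[]. Qed.

Lemma boundary_equiv xi u v : sval xi u -> sval xi v -> gromov_equiv u v.
Proof.
case: xi => A [w gw AE] /=; rewrite AE => -[_ wu] [_ wv].
exact: gromov_equiv_trans (gromov_equiv_sym wu) wv.
Qed.

Lemma boundary_eq xi eta u v :
  sval xi u -> sval eta v -> gromov_equiv u v -> xi = eta.
Proof.
case: xi => A [a ga AE]; case: eta => B [b gb BE] /= Au Bv uv.
apply: eq_exist => /=; rewrite AE BE.
rewrite {}AE in Au; rewrite {}BE in Bv.
have ab : gromov_equiv a b.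
  apply: (gromov_equiv_trans Au.2); apply: (gromov_equiv_trans uv).
  exact/gromov_equiv_sym/Bv.2.
apply/seteqP; split => w [gw aw]; split => //.
  exact: gromov_equiv_trans (gromov_equiv_sym ab) aw.
exact: gromov_equiv_trans ab aw.
Qed.

Definition cvg2 (a : nat -> nat -> R) (l : R) := forall e, 0 < e ->
  exists N, forall i j, (N <= i)%N -> (N <= j)%N -> `|a i j - l| <= e.

(** By the triangle inequality, u_i and v_j can each be moved at the cost of the
    visual distance that they travel, which is small far along a Gromov
    sequence. *)
Lemma visual_dist_cvg x u v : gromov_seq u -> gromov_seq v ->
  exists l, cvg2 (fun i j => visual_dist x (u i) (v j)) l.
Proof.
move=> /(gromov_equivP x) gu /(gromov_equivP x) gv.
pose F := (visual_dist x (u ij.1) (v ij.2)) @[ij --> (\oo, \oo)].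
have cF : cauchy_ex F.
  move=> e e0; have e20 : 0 < e / 3 by rewrite divr_gt0.
  have [M hM] := gu _ e20; have [N hN] := gv _ e20.
  pose K := maxn M N; exists (visual_dist x (u K) (v K)).
  apply/near_infty2P.
  exists K => i j; rewrite !geq_max => /andP[Mi Ni] /andP[Mj Nj].
  rewrite /ball/=; apply: (le_lt_trans (visual_dist_quad cat _ _ _ _ _)).
  have := hM K i (leq_maxl _ _) Mi; have := hN K j (leq_maxr _ _) Nj; lra.
have /cauchy_cvgP : cauchy F by exact: cauchy_exP.
move=> /cvg_ex[l /cvgrPdist_le Fl]; exists l => e e0.
have /near_infty2P[N h] := Fl e e0.
by exists N => i j Ni Nj; rewrite distrC; exact: h.
Qed.

Lemma cvg2_visual_dist_equiv x u v u' v' l :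
  gromov_equiv u u' -> gromov_equiv v v' ->
  cvg2 (fun i j => visual_dist x (u i) (v j)) l ->
  cvg2 (fun i j => visual_dist x (u' i) (v' j)) l.
Proof.
move=> /(gromov_equivP x) gu /(gromov_equivP x) gv h e e0.
have e20 : 0 < e / 3 by rewrite divr_gt0.
have [M hM] := gu _ e20; have [N hN] := gv _ e20; have [K hK] := h _ e20.
exists (maxn M (maxn N K)) => i j.
rewrite !geq_max => /and3P[Mi Ni Ki] /and3P[Mj Nj Kj].
have := hM i i Mi Mi; have := hN j j Nj Nj; have := hK i j Ki Kj.
have := visual_dist_quad cat x (u i) (v j) (u' i) (v' j).
rewrite !ler_norml => /andP[? ?] /andP[? ?] ? ?; apply/andP; split; lra.
Qed.

Lemma cvg2_visual_dist_ge0 x u v l :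
  cvg2 (fun i j => visual_dist x (u i) (v j)) l -> 0 <= l.
Proof.
move=> h; rewrite leNgt; apply/negP => l0; have [|N hN] := h (- l / 2).
  by rewrite divr_gt0// oppr_gt0.
have := hN N N (leqnn _) (leqnn _); have := visual_dist_gt0 x (u N) (v N).
by rewrite ler_norml => ? /andP[? ?]; lra.
Qed.

Lemma cvg2_gromov_product x u v l : cvg2 (fun i j => visual_dist x (u i) (v j)) l ->
  (gromov_product x (u ij.1) (v ij.2))%:E @[ij --> (\oo, \oo)] --> (- lne l%:E)%E.
Proof.
move=> h; have l0 := cvg2_visual_dist_ge0 h.
have [lE|l1] := eqVneq l 0.
  rewrite lE /= lexx.
  suff uv : gromov_equiv u v by apply/cvgeryP; exact: uv x.
  apply/(gromov_equivP x) => e /h[N hN]; exists N => i j Ni Nj.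
  by have := hN _ _ Ni Nj; rewrite lE subr0; exact: (le_trans (ler_norm _)).
have {}l0 : 0 < l by rewrite lt_def l1.
rewrite lne_EFin// -EFinN; apply: cvg_EFin; first exact: nearW.
have -> : fine \o (fun ij : nat * nat => (gromov_product x (u ij.1) (v ij.2))%:E) =
    (fun ij => - ln (visual_dist x (u ij.1) (v ij.2))).
  by apply/funext => ij/=; rewrite /visual_dist expRK opprK.
have c : visual_dist x (u ij.1) (v ij.2) @[ij --> (\oo, \oo)] --> l.
  apply/cvgrPdist_le => e /h[N hN].
  apply/near_infty2P; exists N => i j Ni Nj.
  by rewrite distrC hN.
by apply: cvgN; exact: (cvg_comp _ _ c (continuous_ln l0)).
Qed.

(** The visual metric of the boundary as a limit of visual distances in the
    space: the limit exists along one pair of representatives, and equivalent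
    sequences have the same one, so the value selected by the definition of the
    extended Gromov product is minus the logarithm of that limit. *)
Lemma visual_metric_cvg x xi eta u v : sval xi u -> sval eta v ->
  cvg2 (fun i j => visual_dist x (u i) (v j)) (visual_metric x xi eta).
Proof.
move=> xu ev; have [l hl] := visual_dist_cvg x (boundary_seq xu) (boundary_seq ev).
suff -> : visual_metric x xi eta = l by [].
have l0 := cvg2_visual_dist_ge0 hl.
rewrite /visual_metric.
have -> : boundary_gromov_product x xi eta = (- lne l%:E)%E.
  rewrite /boundary_gromov_product; set P := [set l0 | _].
  have Pl : P (- lne l%:E)%E.
    move=> u' v' xu' ev'; apply: cvg2_gromov_product.
    exact: cvg2_visual_dist_equiv (boundary_equiv xu xu') (boundary_equiv ev ev') hl.
  have /(_ u v xu ev) c1 := getPex (ex_intro P _ Pl).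
  have c2 := Pl u v xu ev.
  exact: (cvg_unique _ c1 c2).
by rewrite oppeK lneK ?in_itv/= ?lee_fin ?l0 ?leey.
Qed.

Lemma cvg2_le (a b : nat -> nat -> R) l m : cvg2 a l -> cvg2 b m ->
  (exists N, forall i j, (N <= i)%N -> (N <= j)%N -> a i j <= b i j) -> l <= m.
Proof.
move=> al bm [K ab]; apply/ler_addgt0Pl => e e0.
have e20 : 0 < e / 2 by rewrite divr_gt0.
have [M hM] := al _ e20; have [N hN] := bm _ e20.
pose L := maxn K (maxn M N).
have KL : (K <= L)%N by rewrite leq_max leqnn.
have ML : (M <= L)%N by rewrite !leq_max leqnn orbT.
have NL : (N <= L)%N by rewrite !leq_max leqnn !orbT.
have := ab _ _ KL KL; have := hM _ _ ML ML; have := hN _ _ NL NL.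
by rewrite !ler_norml => /andP[? ?] /andP[? ?] ?; lra.
Qed.

Lemma visual_metric_sym x xi eta : visual_metric x xi eta = visual_metric x eta xi.
Proof.
have [u xu] := boundary_rep xi; have [v ev] := boundary_rep eta.
have h1 := visual_metric_cvg x xu ev; have h2 := visual_metric_cvg x ev xu.
apply/eqP; rewrite eq_le; apply/andP; split.
  apply: (cvg2_le h1 (_ : cvg2 (fun i j => visual_dist x (v j) (u i)) _)).
    by move=> e /h2[N h]; exists N => i j Ni Nj; exact: h.
  by exists 0%N => i j _ _; rewrite visual_dist_sym.
apply: (cvg2_le h2 (_ : cvg2 (fun i j => visual_dist x (u j) (v i)) _)).
  by move=> e /h1[N h]; exists N => i j Ni Nj; exact: h.
by exists 0%N => i j _ _; rewrite visual_dist_sym.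
Qed.

Lemma visual_metric_eq0 x xi eta : visual_metric x xi eta = 0 <-> xi = eta.
Proof.
have [u xu] := boundary_rep xi; have [v ev] := boundary_rep eta.
have h := visual_metric_cvg x xu ev.
split=> [E|E].
  apply: (boundary_eq xu ev); apply/(gromov_equivP x) => e /h[N hN].
  exists N => i j Ni Nj; have := hN _ _ Ni Nj.
  by rewrite E subr0; exact: (le_trans (ler_norm _)).
rewrite -{eta}E in ev h *.
have /(gromov_equivP x) uv := boundary_equiv xu ev.
have z2 : cvg2 (fun _ _ => 0) 0 by move=> e e0; exists 0%N => *; rewrite subrr normr0 ltW.
have {}uv : cvg2 (fun i j => visual_dist x (u i) (v j)) 0.
  move=> e /uv[N hN]; exists N => i j Ni Nj.
  by rewrite subr0 ger0_norm ?hN// ltW// visual_dist_gt0.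
by apply/eqP; rewrite eq_le (cvg2_le h uv) ?(cvg2_le uv h)//; exists 0%N.
Qed.

Lemma visual_metric_triangle x xi zeta eta :
  visual_metric x xi eta <= visual_metric x xi zeta + visual_metric x zeta eta.
Proof.
have [u xu] := boundary_rep xi; have [v ev] := boundary_rep eta.
have [w zw] := boundary_rep zeta.
have h1 := visual_metric_cvg x xu ev; have h2 := visual_metric_cvg x xu zw.
have h3 := visual_metric_cvg x zw ev.
apply/ler_addgt0Pl => e e0; have e30 : 0 < e / 3 by rewrite divr_gt0.
have [M hM] := h1 _ e30; have [N hN] := h2 _ e30; have [K hK] := h3 _ e30.
pose L := maxn K (maxn M N).
have KL : (K <= L)%N by rewrite leq_max leqnn.
have ML : (M <= L)%N by rewrite !leq_max leqnn orbT.
have NL : (N <= L)%N by rewrite !leq_max leqnn !orbT.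
have := hM _ _ ML ML; have := hN _ _ NL NL; have := hK _ _ KL KL.
have := visual_dist_triangle cat x (u L) (w L) (v L).
by rewrite !ler_norml => ? /andP[? ?] /andP[? ?] /andP[? ?]; lra.
Qed.

End boundary.

Record is_metric {R : realType} (S : Type) (dS : S -> S -> R) : Prop := IsMetric {
  is_metric_eq0 : forall a b, dS a b = 0 <-> a = b;
  is_metric_sym : forall a b, dS a b = dS b a;
  is_metric_triangle : forall b a c, dS a c <= dS a b + dS b c }.

Lemma is_metric_ge0 {R : realType} (S : Type) (dS : S -> S -> R) a b :
  is_metric dS -> 0 <= dS a b.
Proof.
move=> m; have := is_metric_triangle m b a a.
by rewrite (is_metric_sym m b a) ((is_metric_eq0 m a a).2 erefl); lra.
Qed.

Lemma visual_metric_is_metric {R : realType} (X : metricType R) (x : X) :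
  CATm1 X -> is_metric (visual_metric x).
Proof.
move=> cat; split; [exact: visual_metric_eq0|exact: visual_metric_sym|].
by move=> zeta xi eta; exact: visual_metric_triangle.
Qed.

(** * Approximation of boundary points by points of the space *)

Section shadows.
Context {R : realType} (X : metricType R) (cat : CATm1 X).
Implicit Types (x y z : X) (u v : nat -> X) (xi eta : gromov_boundary X).

(** The visual distance from y to the boundary point xi is at most e, without
    extending that distance to pairs of a point and a boundary point. *)
Definition shadows x (e : R) y xi := exists2 u, sval xi u &
  exists N, forall i, (N <= i)%N -> visual_dist x y (u i) <= e.

Lemma shadows_trans x y z d e xi : visual_dist x z y <= d ->
  shadows x e y xi -> shadows x (d + e) z xi.
Proof.
move=> zy [u xu [N h]]; exists u => //; exists N => i /h.
by have := visual_dist_triangle cat x z y (u i); lra.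
Qed.

Lemma shadows_le x y d e xi : d <= e -> shadows x d y xi -> shadows x e y xi.
Proof.
by move=> de [u xu [N h]]; exists u => //; exists N => i /h /le_trans; apply.
Qed.

Lemma visual_metric_shadows x e y z xi eta :
  shadows x e y xi -> shadows x e z eta ->
  `|visual_metric x xi eta - visual_dist x y z| <= 2 * e.
Proof.
move=> [u xu [M hM]] [v ev [N hN]].
apply/ler_addgt0Pl => d d0.
have [K hK] := visual_metric_cvg cat x xu ev d0.
pose L := maxn K (maxn M N).
have KL : (K <= L)%N by rewrite leq_max leqnn.
have ML : (M <= L)%N by rewrite !leq_max leqnn orbT.
have NL : (N <= L)%N by rewrite !leq_max leqnn !orbT.
have := hM _ ML; have := hN _ NL; have := hK _ _ KL KL.
have := visual_dist_quad cat x y z (u L) (v L).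
rewrite !ler_norml => /andP[? ?] /andP[? ?] ? ?; apply/andP; split; lra.
Qed.

(** Every boundary point is visually close to a point of the sphere of radius r:
    a point of that sphere on the segment from x to a remote term of a
    representing sequence. This replaces the geodesic ray from x to xi. *)
Lemma exists_shadowing_point x xi r : 0 < r ->
  exists2 y, mdist x y = r & shadows x (2 * expR (- r)) y xi.
Proof.
move=> r0; have [u xu] := boundary_rep xi.
have /(gromov_equivP x)/(_ _ (expR_gt0 (- r)))[N hN] := boundary_seq xu.
have rN : r <= mdist x (u N).
  have := hN N N (leqnn _) (leqnn _); rewrite /visual_dist ler_expR lerN2.
  by rewrite /gromov_product mdistxx subr0 (metric_sym _ x); lra.
have [c [cg c0 c1]] := cat.1 x (u N).
have rI : r \in `[0, mdist x (u N)] by rewrite in_itv/= ltW.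
have I0 : 0 \in `[0, mdist x (u N)] by rewrite in_itv/= lexx mdist_ge0.
have I1 : mdist x (u N) \in `[0, mdist x (u N)] by rewrite in_itv/= lexx mdist_ge0.
have xr : mdist x (c r) = r by rewrite -{1}c0 cg// sub0r normrN gtr0_norm.
have rx : mdist (c r) (u N) = mdist x (u N) - r.
  by rewrite -{1}c1 cg// distrC ger0_norm// subr_ge0.
exists (c r) => //.
rewrite mulr_natl mulr2n; apply: (@shadows_trans _ (u N)).
  rewrite /visual_dist ler_expR lerN2 /gromov_product rx !(metric_sym _ x) xr; lra.
by exists u => //; exists N => i; exact: hN.
Qed.

(** Conversely, extend the segment from x to y to a geodesic line: its positive
    half converges to a boundary point, and (y | l i)_x = d(x, y) once l i is
    beyond y. *)
Lemma exists_shadowed_boundary_point x y : geodesically_complete X -> x != y ->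
  exists xi, shadows x (expR (- mdist x y)) y xi.
Proof.
rewrite -mdist_gt0 => gcX xy; have [c [cg c0 c1]] := cat.1 x y.
have [l lg lc] := gcX _ _ _ xy cg.
have I0 : 0 \in `[0, mdist x y] by rewrite in_itv/= lexx mdist_ge0.
have I1 : mdist x y \in `[0, mdist x y] by rewrite in_itv/= lexx mdist_ge0.
have lx : l 0 = x by rewrite lc.
have ly : l (mdist x y) = y by rewrite lc.
have lp s t : 0 <= s -> s <= t -> gromov_product x (l s) (l t) = s.
  move=> s0 st; rewrite /gromov_product -lx !lg// !subr0.
  rewrite (ger0_norm s0) (ger0_norm (le_trans s0 st)) distrC ger0_norm ?subr_ge0//.
  lra.
pose u i := l i%:R.
have gu : gromov_seq u.
  move=> p; move: p; apply/(gromov_equivP x) => e e0.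
  exists (Num.truncn (- ln e)).+1 => i j Ni Nj.
  suff : expR (- (Num.truncn (- ln e)).+1%:R) <= e.
    apply: le_trans; rewrite /visual_dist ler_expR lerN2.
    wlog ij : i j Ni Nj / (i <= j)%N => [hh|].
      have [ij|/ltnW ji] := leqP i j; first exact: hh.
      by rewrite gromov_product_sym; exact: hh.
    by rewrite lp ?ler_nat.
  rewrite -[leRHS](lnK (_ : e \is Num.pos))// ler_expR lerNl ltW//.
  exact: truncnS_gt.
have [xi xiE] : exists xi : gromov_boundary X, sval xi = gromov_class u.
  have P : exists2 w, gromov_seq w & gromov_class u = gromov_class w by exists u.
  by exists (exist (fun A : set (nat -> X) => exists2 w, gromov_seq w &
    A = gromov_class w) _ P).
exists xi; exists u; first by rewrite xiE; split.
exists (Num.truncn (mdist x y)).+1 => i Ni.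
rewrite /visual_dist ler_expR lerN2 -{2}ly lp ?mdist_ge0//.
by rewrite (le_trans (ltW (truncnS_gt _)))// ler_nat.
Qed.

End shadows.

(** * Gluing two metric spaces along a correspondence *)

Section gluing.
Context {R : realType} (S T : Type) (dS : S -> S -> R) (dT : T -> T -> R).
Context (mS : is_metric dS) (mT : is_metric dT).
Context (rel : S -> T -> Prop) (e : R) (e0 : 0 < e).
Context (relS : forall a, exists b, rel a b).
Context (relT : forall b, exists a, rel a b).
Context (distort : forall a b a' b', rel a b -> rel a' b' ->
  `|dS a a' - dT b b'| <= 2 * e).

(** The lengths of the paths from a to b that cross from S to T once, along an
    edge of length e between related points. *)
Definition bridges (a : S) (b : T) : set R :=
  [set r | exists a' b', rel a' b' /\ r = dS a a' + dT b' b + e].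

Definition bridge a b : R := inf (bridges a b).

Lemma bridges_ge a b r : bridges a b r -> e <= r.
Proof.
move=> [a' [b' [_ ->]]].
by have := is_metric_ge0 a a' mS; have := is_metric_ge0 b' b mT; lra.
Qed.

Lemma bridge_le a b a' b' : rel a' b' -> bridge a b <= dS a a' + dT b' b + e.
Proof.
move=> ab; apply: ge_inf; last by exists a', b'.
by exists e => r; exact: bridges_ge.
Qed.

Lemma bridge_ge a b m :
  (forall a' b', rel a' b' -> m <= dS a a' + dT b' b + e) -> m <= bridge a b.
Proof.
move=> h; apply: lb_le_inf.
  by have [b' ab] := relS a; exists (dS a a + dT b' b + e), a, b'.
by move=> r [a' [b' [ab ->]]]; exact: h.
Qed.

Definition glued_dist (p q : S + T) : R :=
  match p, q with
  | inl a, inl a' => dS a a'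
  | inr b, inr b' => dT b b'
  | inl a, inr b | inr b, inl a => bridge a b
  end.

Lemma bridge_gt0 a b : 0 < bridge a b.
Proof.
apply: (lt_le_trans e0); apply: bridge_ge => a' b' ab.
by apply: (@bridges_ge a b); exists a', b'.
Qed.

Lemma glued_distxx p : glued_dist p p = 0.
Proof. by case: p => [a|b]; [apply/(is_metric_eq0 mS)|apply/(is_metric_eq0 mT)]. Qed.

Lemma glued_dist_eq0 p q : glued_dist p q = 0 -> p = q.
Proof.
case: p q => [a|b] [a'|b'] /=.
- by move=> /(is_metric_eq0 mS) ->.
- by move=> h; have := bridge_gt0 a b'; rewrite h ltxx.
- by move=> h; have := bridge_gt0 a' b; rewrite h ltxx.
- by move=> /(is_metric_eq0 mT) ->.
Qed.

Lemma glued_dist_sym p q : glued_dist p q = glued_dist q p.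
Proof.
case: p q => [a|b] [a'|b'] //=.
- exact: is_metric_sym mS _ _.
- exact: is_metric_sym mT _ _.
Qed.

Lemma bridge_left a a' b : bridge a b <= dS a a' + bridge a' b.
Proof.
rewrite addrC -lerBlDr; apply: bridge_ge => a2 b2 ab.
by have := bridge_le a b ab; have := is_metric_triangle mS a' a a2; lra.
Qed.

Lemma bridge_right a b b' : bridge a b <= bridge a b' + dT b' b.
Proof.
rewrite -lerBlDr; apply: bridge_ge => a2 b2 ab.
by have := bridge_le a b ab; have := is_metric_triangle mT b' b2 b; lra.
Qed.

(** A path that crosses and returns pays 2 * e for the edges, which makes up for
    the distortion of the relation. *)
Lemma bridge_round_tripS a a' b : dS a a' <= bridge a b + bridge a' b.
Proof.
rewrite -lerBlDr; apply: bridge_ge => a1 b1 ab1.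
rewrite lerBlDl -lerBlDr; apply: bridge_ge => a2 b2 ab2.
have := distort ab1 ab2; rewrite ler_norml => /andP[_].
have := is_metric_triangle mS a1 a a'; have := is_metric_triangle mS a2 a1 a'.
have := is_metric_triangle mT b b1 b2.
by rewrite (is_metric_sym mS a2 a') (is_metric_sym mT b b2); lra.
Qed.

Lemma bridge_round_tripT a b b' : dT b b' <= bridge a b + bridge a b'.
Proof.
rewrite -lerBlDr; apply: bridge_ge => a1 b1 ab1.
rewrite lerBlDl -lerBlDr; apply: bridge_ge => a2 b2 ab2.
have := distort ab1 ab2; rewrite ler_norml => /andP[+ _].
have := is_metric_triangle mT b1 b b'; have := is_metric_triangle mT b2 b1 b'.
have := is_metric_triangle mS a a1 a2.
by rewrite (is_metric_sym mS a1 a) (is_metric_sym mT b b1); lra.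
Qed.

Lemma glued_dist_triangle q p r :
  glued_dist p r <= glued_dist p q + glued_dist q r.
Proof.
case: p q r => [a|b] [a'|b'] [a2|b2] /=.
- exact: is_metric_triangle mS _ _ _.
- exact: bridge_left.
- exact: bridge_round_tripS.
- exact: bridge_right.
- by rewrite addrC (is_metric_sym mS); exact: bridge_left.
- exact: bridge_round_tripT.
- by rewrite addrC (is_metric_sym mT); exact: bridge_right.
- exact: is_metric_triangle mT _ _ _.
Qed.

(** A correspondence of distortion at most 2 * e bounds the Gromov-Hausdorff
    distance by e: in the metric glued along its edges, related points are at
    distance e. The length of the edges is positive, so that points of S and T
    stay distinct. *)
Lemma gromov_hausdorff_distance_le : (gromov_hausdorff_distance dS dT <= e%:E)%E.
Proof.
pose C : choiceType := HB.pack (S + T)%type (gen_choiceMixin (S + T)%type)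
   (gen_eqMixin (S + T)%type).
pose Z : metricType R := HB.pack C
  (isMetric.Build R C glued_distxx glued_dist_eq0 glued_dist_sym glued_dist_triangle).
apply: (@le_trans _ _ 
  (hausdorff_distance (range (inl : S -> Z)) (range (inr : T -> Z)))).
  apply: ereal_inf_lbound; exists Z, inl, inr; split => //.
    by split => // a b [].
  by split => // a b [].
have relb a b : rel a b -> bridge a b <= e.
  move=> ab; have := bridge_le a b ab.
  by rewrite ((is_metric_eq0 mS a a).2 erefl) ((is_metric_eq0 mT b b).2 erefl) !add0r.
apply: ereal_inf_lbound; exists e => //; split; first exact: ltW.
  move=> _ [a _ <-]; have [b ab] := relS a; exists (inr b); first by exists b.
  exact: relb.
move=> _ [b _ <-]; have [a ab] := relT b; exists (inl a); first by exists a.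
exact: relb.
Qed.

End gluing.

Lemma hausdorff_distance_ge0 {R : realType} (Z : metricType R) (A B : set Z) :
  (0 <= hausdorff_distance A B)%E.
Proof. by apply: le_ereal_inf_tmp => _ [e [e0 _ _] <-]; rewrite lee_fin. Qed.

Lemma gromov_hausdorff_distance_ge0 {R : realType} (S T : Type)
    (dS : S -> S -> R) (dT : T -> T -> R) :
  (0 <= gromov_hausdorff_distance dS dT)%E.
Proof.
by apply: le_ereal_inf_tmp => _ [Z [f [g [_ _ ->]]]]; exact: hausdorff_distance_ge0.
Qed.

Lemma cvge0_squeeze {R : realType} (u : nat -> \bar R) :
  (forall n, 0 <= u n)%E ->
  (forall e, 0 < e -> \forall n \near \oo, (u n <= e%:E)%E) ->
  u n @[n --> \oo] --> 0%E.
Proof.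
move=> u0 ue; apply/fine_cvgP; split.
  apply: filterS (ue 1 ltr01) => n un.
  by rewrite ge0_fin_numE//; exact: le_lt_trans un (ltry _).
apply/cvgrPdist_le => e e0; apply: filterS (ue e e0) => n un.
rewrite sub0r normrN /= ger0_norm ?fine_ge0//.
rewrite -lee_fin fineK// ge0_fin_numE//; exact: le_lt_trans un (ltry _).
Qed.

(** * Convergence of the boundaries *)

Section comparison.
Context {R : realType} (X Y : metricType R) (x : X) (y : Y).
Context (catX : CATm1 X) (catY : CATm1 Y).
Context (gcX : geodesically_complete X) (gcY : geodesically_complete Y).
Context (r d : R) (r1 : 1 < r) (d0 : 0 < d) (d1 : d <= 1 / 2).
Context (f : X -> Y) (fx : f x = y).
Context (fiso : eps_isometry (mclosed_ball x r) (mclosed_ball y r) d f).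

Lemma eps_isometry_distort a b : mclosed_ball x r a -> mclosed_ball x r b ->
  `|mdist (f a) (f b) - mdist a b| <= d.
Proof.
move=> xa xb; have [_ fd _] := fiso.
rewrite -lee_fin; apply: le_trans (ltW fd); apply: ereal_sup_ubound.
by exists (a, b).
Qed.

Lemma eps_isometry_base a : mclosed_ball x r a ->
  `|mdist y (f a) - mdist x a| <= d.
Proof.
move=> xa; rewrite -fx; apply: eps_isometry_distort => //.
by rewrite /mclosed_ball/= mdistxx; move: r1; lra.
Qed.

Lemma visual_dist_eps_isometry a b : mclosed_ball x r a -> mclosed_ball x r b ->
  `|visual_dist x a b - visual_dist y (f a) (f b)| <= 2 * d.
Proof.
move=> xa xb; apply: le_trans
  (dist_expRN (gromov_product_ge0 _ _ _) (gromov_product_ge0 _ _ _)) _.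
have := eps_isometry_base xa; have := eps_isometry_base xb.
have := eps_isometry_distort xa xb.
rewrite /gromov_product !(metric_sym _ x) !(metric_sym _ y) !ler_norml.
by move=> /andP[? ?] /andP[? ?] /andP[? ?]; apply/andP; split; lra.
Qed.

(** Boundary points correspond when they are seen behind a point of the ball and
    its image. The radius exp (2 - r) leaves room for the losses of both
    constructions of partners: the geodesic is extended beyond a point that may
    fall short of the sphere of radius r by up to 1, and when a partner of eta
    is sought, the errors exp (1 - r) and 2 exp (- r) add up. *)
Definition boundary_rel (xi : gromov_boundary X) (eta : gromov_boundary Y) :=
  exists2 a, mclosed_ball x r a &
    shadows x (expR (2 - r)) a xi /\ shadows y (expR (2 - r)) (f a) eta.

Lemma expR1_ge2 : 2 <= expR 1 :> R.
Proof. by have := expR_ge1Dx (1 : R); lra. Qed.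

Lemma boundary_rel_total xi : exists eta, boundary_rel xi eta.
Proof.
have r0 : 0 < r by move: r1; lra.
have [a xa sa] := exists_shadowing_point catX x xi r0.
have Ba : mclosed_ball x r a by rewrite /mclosed_ball/= xa.
have := eps_isometry_base Ba; rewrite xa ler_norml => /andP[h _].
have [|eta ea] := @exists_shadowed_boundary_point _ _ catY y (f a) gcY.
  by rewrite -mdist_gt0; move: h r1 d1; lra.
exists eta, a => //; split.
  apply: shadows_le sa; rewrite expRD ler_wpM2r ?expR_ge0//.
  by have := expR_ge1Dx (2 : R); lra.
by apply: shadows_le ea; rewrite ler_expR; move: h r1 d1; lra.
Qed.

Lemma boundary_rel_surj eta : exists xi, boundary_rel xi eta.
Proof.
have r0 : 0 < r by move: r1; lra.
have [b yb sb] := exists_shadowing_point catY y eta r0.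
have Bb : mclosed_ball y r b by rewrite /mclosed_ball/= yb.
(* b need not be an image, but it is d-close to one, f a; then a is at distance
   at least r - 2 * d >= r - 1 from x. *)
have [_ _ /(_ _ Bb)[a Ba]] := fiso.
rewrite /mclosed_ball/= => fab.
have := eps_isometry_base Ba; rewrite ler_norml => /andP[h1 h2].
have h3 := metric_triangle y (f a) b; rewrite yb in h3.
have [|xi ea] := @exists_shadowed_boundary_point _ _ catX x a gcX.
  by rewrite -mdist_gt0; move: h1 h2 h3 r1 d1 fab; lra.
exists xi, a => //; split.
  by apply: shadows_le ea; rewrite ler_expR; move: h1 h2 h3 r1 d1 fab; lra.
have : visual_dist y (f a) b <= expR (1 - r).
  rewrite /visual_dist ler_expR /gromov_product !(metric_sym _ y) yb.
  by move: h1 h2 h3 r1 d1 fab; lra.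
move=> /(shadows_trans catY)/(_ sb); apply: shadows_le.
rewrite (expRD 1) (expRD 2) -mulrDl ler_wpM2r ?expR_ge0//.
by rewrite (expRD 1 1); have := expR1_ge2; nra.
Qed.

(** Each boundary point can be replaced by the point in front of it at the cost
    exp (2 - r), and visual distances within the balls differ by 2 * d. *)
Lemma boundary_rel_distort xi eta xi' eta' :
  boundary_rel xi eta -> boundary_rel xi' eta' ->
  `|visual_metric x xi xi' - visual_metric y eta eta'| <=
  2 * (2 * expR (2 - r) + d).
Proof.
move=> [a Ba [sa ta]] [b Bb [sb tb]].
have := visual_metric_shadows catX sa sb; have := visual_metric_shadows catY ta tb.
have := visual_dist_eps_isometry Ba Bb.
rewrite !ler_norml => /andP[? ?] /andP[? ?] /andP[? ?]; apply/andP; split; lra.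
Qed.

Lemma gromov_hausdorff_boundary_le :
  (gromov_hausdorff_distance (visual_metric x) (visual_metric y)
    <= (2 * expR (2 - r) + d)%:E)%E.
Proof.
apply: (gromov_hausdorff_distance_le (visual_metric_is_metric x catX)
  (visual_metric_is_metric y catY) _ boundary_rel_total boundary_rel_surj).
  by rewrite addr_gt0// mulr_gt0// expR_gt0.
exact: boundary_rel_distort.
Qed.

End comparison.

Theorem theorem1p4 (R : realType)
  (X_ : nat -> metricType R) (x_ : forall n, X_ n)
  (X : metricType R) (x : X)
  (X_proper : forall n, proper_space (X_ n))
  (X_complete : forall n, geodesically_complete (X_ n))
  (X_CATm1 : forall n, CATm1 (X_ n))
  (Xproper : proper_space X)
  (Xcomplete : geodesically_complete X)
  (XCATm1 : CATm1 X)
  (X_cvg : pointed_GH_cvg x_ x) :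
  gromov_hausdorff_distance (visual_metric (x_ n)) (visual_metric x)
    @[n --> \oo] --> 0%E.
Proof.
apply: cvge0_squeeze => [n|e e0]; first exact: gromov_hausdorff_distance_ge0.
pose d := Num.min (1 / 2) (e / 2).
pose r := Num.max 2 (2 - ln (e / 4)).
have d0 : 0 < d by rewrite lt_min !divr_gt0.
have r1 : 1 < r by rewrite lt_max; apply/orP; left; lra.
have r0 : 0 < r by lra.
apply: filterS (X_cvg r d r0 d0) => n [f fiso fx].
have d1 : d <= 1 / 2 by rewrite ge_min lexx.
apply: le_trans (gromov_hausdorff_boundary_le (X_CATm1 n) XCATm1 (X_complete n)
  Xcomplete r1 d0 d1 fx fiso) _.
rewrite lee_fin.
have de : d <= e / 2 by rewrite ge_min lexx orbT.
have e4 : 0 < e / 4 by rewrite divr_gt0.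
have : expR (2 - r) <= e / 4.
  rewrite -[leRHS](lnK (_ : _ \is Num.pos))// ler_expR lerBlDr addrC -lerBlDr.
  by rewrite le_max lexx orbT.
by lra.
Qed.
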